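(* Let $n\ge2$, let $(a_i,b_i)$, $i=1,\dots,n$, be pairwise linearly independent vectors in $\mathbb{R}^2$, let $s\ge n-2$ be an integer, and suppose $f\in C^s(\mathbb{R}^2)$ has the form $f(x,y)=\sum_{i=1}^nf_i(a_ix+b_iy)$ with arbitrary univariate functions $f_i:\mathbb{R}\to\mathbb{R}$. Then $f$ can also be represented in the form $$f(x,y)=\sum_{i=1}^ng_i(a_ix+b_iy)$$ with $g_i\in C^s(\mathbb{R})$, $i=1,\dots,n$. Moreover, in this representation one can take $$g_p=\varphi_{p,n-p-1},\ p=1,\dots,n-2;\qquad g_{n-1}=h_{1,n-1};\qquad g_n=h_{2,n-1},$$ where the functions $\varphi_{p,k},h_{1,k},h_{2,k}$ are defined inductively by $$h_{1,1}(t)=\frac{\partial^{n-2}f^*}{\partial l_1\cdots\partial l_{n-2}}(t,0),\qquad h_{2,1}(t)=\frac{\partial^{n-2}f^*}{\partial l_1\cdots\partial l_{n-2}}(0,t)-\frac{\partial^{n-2}f^*}{\partial l_1\cdots\partial l_{n-2}}(0,0),$$ $$h_{1,k+1}(t)=\frac1{e_1\cdot l_k}\int_0^th_{1,k}(z)\,dz,\qquad h_{2,k+1}(t)=\frac1{e_2\cdot l_k}\int_0^th_{2,k}(z)\,dz,\qquad k=1,\dots,n-2,$$ $$\varphi_{p,1}(t)=\frac{\partial^{n-p-2}f^*}{\partial l_{p+1}\cdots\partial l_{n-2}}\left(\frac{\widetilde a_pt}{\widetilde a_p^2+\widetilde b_p^2},\frac{\widetilde b_pt}{\widetilde a_p^2+\widetilde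 b_p^2}\right)-h_{1,p+1}\left(\frac{\widetilde a_pt}{\widetilde a_p^2+\widetilde b_p^2}\right)-h_{2,p+1}\left(\frac{\widetilde b_pt}{\widetilde a_p^2+\widetilde b_p^2}\right)-\sum_{j=1}^{p-1}\varphi_{j,p-j+1}\left(\frac{\widetilde a_j\widetilde a_p+\widetilde b_j\widetilde b_p}{\widetilde a_p^2+\widetilde b_p^2}\,t\right)$$ for $p=1,\dots,n-2$ (for $p=n-2$ the derivative term is $f^*$ itself), and $$\varphi_{p,k+1}(t)=\frac1{(\widetilde a_p,\widetilde b_p)\cdot l_{k+p}}\int_0^t\varphi_{p,k}(z)\,dz,\qquad p=1,\dots,n-3,\ k=1,\dots,n-p-2.$$
   Context: Notation: $e_1=(1,0)$, $e_2=(0,1)$; $\cdot$ is the standard inner product; $\frac{\partial}{\partial l}$ is the derivative in the direction $l$ (a zeroth-order derivative of $f^*$ is $f^*$); $C^0=C$. For $p=1,\dots,n-2$, $$\widetilde a_p=\frac{a_pb_n-a_nb_p}{a_{n-1}b_n-a_nb_{n-1}},\qquad\widetilde b_p=\frac{a_{n-1}b_p-a_pb_{n-1}}{a_{n-1}b_n-a_nb_{n-1}},\qquad l_p=\left(\frac{\widetilde b_p}{\sqrt{\widetilde a_p^2+\widetilde b_p^2}},\frac{-\widetilde a_p}{\sqrt{\widetilde a_p^2+\widetilde b_p^2}}\right),$$ and $$f^*(x,y)=f\left(\frac{b_nx-b_{n-1}y}{a_{n-1}b_n-a_nb_{n-1}},\frac{a_nx-a_{n-1}y}{a_nb_{n-1}-a_{n-1}b_n}\right).$$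 *)

(* Defs.v *)
From Stdlib Require Import Reals Lra Lia Arith List.
From Coquelicot Require Export Coquelicot.

Open Scope R_scope.

(* The families (a_i), (b_i) and everything derived from them are functions on
   nat of which only the values at indices i = 1, ..., n matter. *)

Definition lin_indep (u v : R * R) : Prop :=
  forall c d : R,
    c * fst u + d * fst v = 0 -> c * snd u + d * snd v = 0 -> c = 0 /\ d = 0.

Definition dot (u v : R * R) : R := fst u * fst v + snd u * snd v.

Definition e1 : R * R := (1, 0).
Definition e2 : R * R := (0, 1).

Definition CR (s : nat) (g : R -> R) : Prop :=
  forall k x, (k <= s)%nat -> ex_derive_n g k x /\ continuous (Derive_n g k) x.

(* [ex_diff_n f s x y] asks that f and all its iterated partial derivatives of
   order at most s exist and be jointly continuous at (x, y). *)
Definition CR2 (s : nat) (f : R -> R -> R) : Prop :=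
  forall x y, ex_diff_n f s x y.

Definition dir_derive (l : R * R) (F : R -> R -> R) : R -> R -> R :=
  fun x y => Derive (fun t => F (x + t * fst l) (y + t * snd l)) 0.

(* d^(q-p+1) F / dl_p ... dl_q, with dl_q applied first; F itself if q < p. *)
Definition dir_derives (l : nat -> R * R) (p q : nat) (F : R -> R -> R) :
    R -> R -> R :=
  fold_right dir_derive F (map l (seq p (S q - p))).

(* The sequence F_1 = F, F_(k+1)(t) = 1 / c_k * int_0^t F_k(z) dz; the value at
   index 0 is not used. *)
Fixpoint iter_int (c : nat -> R) (F : R -> R) (k : nat) : R -> R :=
  match k with
  | O => fun _ => 0
  | S k' =>
      match k' with
      | O => F
      | S _ => fun t => 1 / c k' * RInt (iter_int c F k') 0 t
      end
  end.

Section Construction.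

Context (n : nat) (a b : nat -> R) (f : R -> R -> R).

Definition ta (p : nat) : R :=
  (a p * b n - a n * b p) / (a (n - 1)%nat * b n - a n * b (n - 1)%nat).

Definition tb (p : nat) : R :=
  (a (n - 1)%nat * b p - a p * b (n - 1)%nat)
  / (a (n - 1)%nat * b n - a n * b (n - 1)%nat).

Definition ldir (p : nat) : R * R :=
  (tb p / sqrt (ta p ^ 2 + tb p ^ 2), - ta p / sqrt (ta p ^ 2 + tb p ^ 2)).

Definition fstar (x y : R) : R :=
  f ((b n * x - b (n - 1)%nat * y)
     / (a (n - 1)%nat * b n - a n * b (n - 1)%nat))
    ((a n * x - a (n - 1)%nat * y)
     / (a n * b (n - 1)%nat - a (n - 1)%nat * b n)).

Definition h1 : nat -> R -> R :=
  iter_int (fun k => dot e1 (ldir k))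
    (fun t => dir_derives ldir 1 (n - 2) fstar t 0).

Definition h2 : nat -> R -> R :=
  iter_int (fun k => dot e2 (ldir k))
    (fun t => dir_derives ldir 1 (n - 2) fstar 0 t
              - dir_derives ldir 1 (n - 2) fstar 0 0).

(* phi_(p,1), given the functions prev j k = phi_(j,k) for j < p. *)
Definition phi_start (prev : nat -> nat -> R -> R) (p : nat) (t : R) : R :=
  dir_derives ldir (p + 1) (n - 2) fstar
      (ta p * t / (ta p ^ 2 + tb p ^ 2)) (tb p * t / (ta p ^ 2 + tb p ^ 2))
  - h1 (p + 1) (ta p * t / (ta p ^ 2 + tb p ^ 2))
  - h2 (p + 1) (tb p * t / (ta p ^ 2 + tb p ^ 2))
  - sum_n_m (fun j => prev j (p - j + 1)%nat
               ((ta j * ta p + tb j * tb p) / (ta p ^ 2 + tb p ^ 2) * t))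
      1 (p - 1).

Definition phi_row (prev : nat -> nat -> R -> R) (p : nat) : nat -> R -> R :=
  iter_int (fun k => dot (ta p, tb p) (ldir (k + p))) (phi_start prev p).

(* phi_upto N p k = phi_(p,k) for 1 <= p <= N: course-of-values recursion on p,
   as phi_(p,1) depends on all phi_(j,k) with j < p. The recurrences that
   characterize phi are proved in phi_1 and phi_S below. *)
Fixpoint phi_upto (N : nat) : nat -> nat -> R -> R :=
  match N with
  | O => fun _ _ _ => 0
  | S N' => fun p =>
      if Nat.eqb p (S N') then phi_row (phi_upto N') p else phi_upto N' p
  end.

Definition phi (p k : nat) : R -> R := phi_upto p p k.

Lemma iter_int_S (c : nat -> R) (F : R -> R) (k : nat) (t : R) :
  (1 <= k)%nat ->
  iter_int c F (S k) t = 1 / c k * RInt (iter_int c F k) 0 t.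
Proof. destruct k as [|k]; [lia | reflexivity]. Qed.

Lemma h1_1 (t : R) : h1 1 t = dir_derives ldir 1 (n - 2) fstar t 0.
Proof. reflexivity. Qed.

Lemma h2_1 (t : R) :
  h2 1 t = dir_derives ldir 1 (n - 2) fstar 0 t
           - dir_derives ldir 1 (n - 2) fstar 0 0.
Proof. reflexivity. Qed.

Lemma h1_S (k : nat) (t : R) :
  (1 <= k)%nat -> h1 (k + 1) t = 1 / dot e1 (ldir k) * RInt (h1 k) 0 t.
Proof. rewrite Nat.add_1_r; apply iter_int_S. Qed.

Lemma h2_S (k : nat) (t : R) :
  (1 <= k)%nat -> h2 (k + 1) t = 1 / dot e2 (ldir k) * RInt (h2 k) 0 t.
Proof. rewrite Nat.add_1_r; apply iter_int_S. Qed.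

Lemma phi_upto_stable (N p : nat) : (p <= N)%nat -> phi_upto N p = phi p.
Proof.
unfold phi.
induction N as [|N IH]; intros H.
- now replace p with 0%nat by lia.
- destruct (Nat.eq_dec p (S N)) as [->|Hp]; [reflexivity|].
  simpl; rewrite (proj2 (Nat.eqb_neq _ _) Hp); apply IH; lia.
Qed.

Lemma phi_rowE (p : nat) :
  (1 <= p)%nat -> phi p = phi_row (phi_upto (p - 1)) p.
Proof.
destruct p as [|p]; [lia|]; intros _.
replace (S p - 1)%nat with p by lia.
unfold phi; simpl; now rewrite Nat.eqb_refl.
Qed.

Lemma phi_1 (p : nat) (t : R) :
  (1 <= p)%nat ->
  phi p 1 t =
  dir_derives ldir (p + 1) (n - 2) fstar
      (ta p * t / (ta p ^ 2 + tb p ^ 2)) (tb p * t / (ta p ^ 2 + tb p ^ 2))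
  - h1 (p + 1) (ta p * t / (ta p ^ 2 + tb p ^ 2))
  - h2 (p + 1) (tb p * t / (ta p ^ 2 + tb p ^ 2))
  - sum_n_m (fun j => phi j (p - j + 1)
               ((ta j * ta p + tb j * tb p) / (ta p ^ 2 + tb p ^ 2) * t))
      1 (p - 1).
Proof.
intros Hp; rewrite (phi_rowE p Hp).
unfold phi_row, iter_int, phi_start; f_equal.
apply sum_n_m_ext_loc; intros j Hj.
now rewrite phi_upto_stable by lia.
Qed.

Lemma phi_S (p k : nat) (t : R) :
  (1 <= p)%nat -> (1 <= k)%nat ->
  phi p (k + 1) t =
  1 / dot (ta p, tb p) (ldir (k + p)) * RInt (phi p k) 0 t.
Proof.
intros Hp Hk; rewrite (phi_rowE p Hp), Nat.add_1_r; now apply iter_int_S.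
Qed.

End Construction.

(* Main.v *)
Require Import Defs.
From Stdlib Require Import Reals Lra Lia Arith List.
Open Scope R_scope.

(* In the coordinates x' = a_(n-1) x + b_(n-1) y, y' = a_n x + b_n y the function
   f* is u(x') + v(y') plus ridge functions along (ta_p, tb_p), p <= n-2, and l_p
   is orthogonal to (ta_p, tb_p).  A difference in the direction l_p kills the
   p-th ridge function without any smoothness of it, so differencing f* along all
   l_p leaves a function of x' plus a function of y'.  This property passes to
   pointwise limits, hence to d^(n-2) f* / dl_1 ... dl_(n-2), which is therefore
   h_(1,1) + h_(2,1).  One then integrates back: if the representation holds for
   d^(n-p-1) f* / dl_p ... dl_(n-2), the difference between
   d^(n-p-2) f* / dl_(p+1) ... dl_(n-2) and the termwise primitives has zero
   derivative along l_p, so it is a function of ta_p x' + tb_p y' only, and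
   evaluating it at the orthogonal projection of (x', y') on the line through
   (ta_p, tb_p) identifies that function as phi_(p,1). *)

(** * Closure properties of functions of class C^k in one variable *)

Lemma is_derive_eq (g : R -> R) (x l l' : R) :
  is_derive g x l -> l = l' -> is_derive g x l'.
Proof. now intros H <-. Qed.

Lemma CR_0 (g : R -> R) : CR 0 g <-> forall x, continuous g x.
Proof.
split.
- intros H x; exact (proj2 (H 0%nat x (Nat.le_refl 0))).
- intros H k x Hk; replace k with 0%nat by lia; split; [exact I | exact (H x)].
Qed.

(** This recursive form turns the closure properties below into inductions on [k] that only have to
    exhibit a first derivative, without formulas for [Derive_n]. *)
Lemma CR_S (k : nat) (g : R -> R) :
  CR (S k) g <-> exists d, (forall x, is_derive g x (d x)) /\ CR k d.
Proof.
split.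
- intros H; exists (Derive g); split.
  + intros x; apply Derive_correct.
    exact (proj1 (H 1%nat x (le_n_S _ _ (Nat.le_0_l k)))).
  + assert (E : forall j x, Derive_n (Derive g) j x = Derive_n g (S j) x).
    { intros j x; change (Derive g) with (Derive_n g 1).
      now rewrite Derive_n_comp, Nat.add_1_r. }
    intros j x Hj; destruct (H (S j) x (le_n_S _ _ Hj)) as [_ Hc]; split.
    * destruct j as [|j]; [exact I|]; simpl.
      apply (ex_derive_ext (Derive_n g (S j))); [intros t; now rewrite E|].
      exact (proj1 (H (S (S j)) x (le_n_S _ _ Hj))).
    * apply (continuous_ext (Derive_n g (S j))); [intros t; now rewrite E|].
      exact Hc.
- intros (d & Hd & Hk).
  assert (E : forall j x, Derive_n g (S j) x = Derive_n d j x).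
  { intros j x; rewrite <- (Nat.add_1_r j), <- Derive_n_comp.
    apply Derive_n_ext; intros t; exact (is_derive_unique _ _ _ (Hd t)). }
  intros [|j] x Hj.
  + split; [exact I|]; apply (ex_derive_continuous g).
    now exists (d x).
  + apply le_S_n in Hj; destruct (Hk j x Hj) as [Hx Hc]; split.
    * destruct j as [|j]; [now exists (d x)|].
      apply (ex_derive_ext (Derive_n d j)); [intros t; now rewrite E|].
      exact Hx.
    * apply (continuous_ext (Derive_n d j)); [intros t; now rewrite E|].
      exact Hc.
Qed.

Lemma CR_continuous (k : nat) (g : R -> R) :
  CR k g -> forall x, continuous g x.
Proof. intros H x; exact (proj2 (H 0%nat x (Nat.le_0_l k))). Qed.

Lemma CR_ext (k : nat) (g h : R -> R) :
  (forall x, g x = h x) -> CR k g -> CR k h.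
Proof.
intros E H j x Hj; destruct (H j x Hj) as [Hx Hc]; split.
- now apply (ex_derive_n_ext g).
- apply (continuous_ext (Derive_n g j)); [|exact Hc].
  intros t; now apply Derive_n_ext.
Qed.

Lemma CR_zero (k : nat) : CR k (fun _ => 0).
Proof.
induction k as [|k IH].
- apply CR_0; intros x; apply continuous_const.
- apply CR_S; exists (fun _ => 0); split; [|exact IH].
  intros x; apply (is_derive_const (V := R_NormedModule)).
Qed.

Lemma CR_plus (k : nat) (g h : R -> R) :
  CR k g -> CR k h -> CR k (fun t => g t + h t).
Proof.
revert g h; induction k as [|k IH]; intros g h.
- rewrite !CR_0; intros Hg Hh x; now apply (continuous_plus (V := R_NormedModule)).
- rewrite !CR_S; intros (dg & Hg & Hg') (dh & Hh & Hh').
  exists (fun t => dg t + dh t); split; [|now apply IH].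
  intros x; now apply (is_derive_plus (V := R_NormedModule)).
Qed.

(** The outer factor [d] makes the family closed under differentiation: the derivative is [d * c]
    times [g'] at [c * t], so the induction can run with [d] generalized. *)
Lemma CR_comp_scal (k : nat) (g : R -> R) (c d : R) :
  CR k g -> CR k (fun t => d * g (c * t)).
Proof.
revert g d; induction k as [|k IH]; intros g d.
- rewrite !CR_0; intros Hg x.
  apply (continuous_scal_r (V := R_NormedModule) d (fun t => g (c * t))).
  apply (continuous_comp (fun t => c * t) g); [|apply Hg].
  apply (continuous_scal_r (V := R_NormedModule) c (fun t : R => t)).
  apply continuous_id.
- rewrite !CR_S; intros (dg & Hg & Hg').
  exists (fun t => (d * c) * dg (c * t)); split; [|now apply IH].
  intros x; eapply is_derive_eq.
  + apply (is_derive_scal (fun t => g (c * t))).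
    apply (is_derive_comp (V := R_NormedModule) g (fun t => c * t)); [apply Hg|].
    apply (is_derive_scal (fun t : R => t)), (is_derive_id (K := R_AbsRing)).
  + unfold scal, one; simpl; unfold mult; simpl; ring.
Qed.

Lemma CR_minus (k : nat) (g h : R -> R) :
  CR k g -> CR k h -> CR k (fun t => g t - h t).
Proof.
intros Hg Hh.
(* The factors [-1] and [1] put the difference in the shape of [CR_plus] and [CR_comp_scal]. *)
apply (CR_ext k (fun t => g t + (-1) * h (1 * t))).
- intros x; replace (1 * x) with x by ring; ring.
- apply CR_plus; [exact Hg | now apply CR_comp_scal].
Qed.

Lemma CR_sum (k : nat) (g : nat -> R -> R) (p q : nat) :
  (forall j, (p <= j <= q)%nat -> CR k (g j)) ->
  CR k (fun t => sum_n_m (fun j => g j t) p q).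
Proof.
induction q as [|q IH]; intros H.
- destruct p as [|p].
  + apply (CR_ext k (g 0%nat)); [intros x; now rewrite sum_n_n|].
    now apply H.
  + apply (CR_ext k (fun _ => 0)); [|apply CR_zero].
    intros x; now rewrite sum_n_m_zero by lia.
- destruct (le_dec p (S q)) as [Hp|Hp].
  + apply (CR_ext k (fun t => sum_n_m (fun j => g j t) p q + g (S q) t)).
    * intros x; now rewrite sum_n_Sm.
    * apply CR_plus; [apply IH; intros; apply H; lia | apply H; lia].
  + apply (CR_ext k (fun _ => 0)); [|apply CR_zero].
    intros x; now rewrite sum_n_m_zero by lia.
Qed.

Lemma is_derive_primitive (c : R) (g : R -> R) (x : R) :
  (forall t, continuous g t) ->
  is_derive (fun t => c * RInt g 0 t) x (c * g x).
Proof.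
intros Hg.
apply (is_derive_scal (fun t => RInt g 0 t)).
apply (is_derive_RInt g (RInt g 0) 0); [|apply Hg].
apply filter_forall; intros t; apply (RInt_correct (V := R_CompleteNormedModule)).
now apply (ex_RInt_continuous (V := R_CompleteNormedModule)).
Qed.

(** Each integration in [iter_int] thus regains the order lost by one directional derivative. *)
Lemma CR_primitive (k : nat) (c : R) (g : R -> R) :
  CR k g -> CR (S k) (fun t => c * RInt g 0 t).
Proof.
intros Hg; apply CR_S; exists (fun t => c * g t); split.
- intros x; apply is_derive_primitive, (CR_continuous k), Hg.
- apply (CR_ext k (fun t => c * g (1 * t))); [|now apply CR_comp_scal].
  intros x; now rewrite Rmult_1_l.
Qed.

(** * Functions of class C^k in two variables, their restrictions to lines and directional
    derivatives *)

(** The two partial derivatives together with the continuity of [D1] make [F] differentiable, and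
    the chain rule applies. *)
Lemma is_derive_comp_2d (F D1 D2 : R -> R -> R) (u v : R -> R) (du dv t : R) :
  (forall x y, is_derive (fun z => F z y) x (D1 x y)) ->
  (forall x y, is_derive (fun z => F x z) y (D2 x y)) ->
  (forall x y, continuity_2d_pt D1 x y) ->
  is_derive u t du -> is_derive v t dv ->
  is_derive (fun z => F (u z) (v z)) t (D1 (u t) (v t) * du + D2 (u t) (v t) * dv).
Proof.
intros H1 H2 Hc Hu Hv; apply is_derive_Reals.
apply derivable_pt_lim_comp_2d; [|now apply is_derive_Reals..].
apply filterdiff_differentiable_pt_lim.
apply (is_derive_filterdiff F (u t) (v t) D1 (D2 (u t) (v t))).
- apply filter_forall; intros z; apply H1.
- apply H2.
- now apply continuity_2d_pt_filterlim.
Qed.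

Lemma CR2_0 (F : R -> R -> R) :
  CR2 0 F <-> forall x y, continuity_2d_pt F x y.
Proof.
split; intros H x y; [exact (proj1 (H x y)) | split; [apply H | exact I]].
Qed.

Lemma CR2_continuity (k : nat) (F : R -> R -> R) :
  CR2 k F -> forall x y, continuity_2d_pt F x y.
Proof. intros H x y; destruct k; exact (proj1 (H x y)). Qed.

Lemma CR2_ext (k : nat) (F G : R -> R -> R) :
  (forall x y, F x y = G x y) -> CR2 k F -> CR2 k G.
Proof.
intros E H x y; apply (ex_diff_n_ext_loc F); [|apply H].
now exists (mkposreal 1 Rlt_0_1).
Qed.

(** The counterpart of [CR_S]: it reduces inductions on the order to exhibiting both partial
    derivatives. *)
Lemma CR2_S (k : nat) (F : R -> R -> R) :
  CR2 (S k) F <->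
  exists D1 D2,
    (forall x y, is_derive (fun z => F z y) x (D1 x y)) /\
    (forall x y, is_derive (fun z => F x z) y (D2 x y)) /\
    CR2 k D1 /\ CR2 k D2.
Proof.
split.
- intros H.
  exists (fun x y => Derive (fun z => F z y) x), (fun x y => Derive (fun z => F x z) y).
  split; [|split; [|split]]; intros x y; destruct (H x y) as (_ & H1 & H2 & H3 & H4);
    [now apply Derive_correct | now apply Derive_correct | exact H3 | exact H4].
- intros (D1 & D2 & H1 & H2 & C1 & C2) x y; repeat split.
  + apply differentiable_continuity_pt; exists (D1 x y), (D2 x y).
    apply filterdiff_differentiable_pt_lim.
    apply (is_derive_filterdiff F x y D1 (D2 x y)).
    * apply filter_forall; intros z; apply H1.
    * apply H2.
    * apply continuity_2d_pt_filterlim; now apply (CR2_continuity k).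
  + now exists (D1 x y).
  + now exists (D2 x y).
  + apply (CR2_ext k D1); [|exact C1].
    intros u v; symmetry; apply is_derive_unique, H1.
  + apply (CR2_ext k D2); [|exact C2].
    intros u v; symmetry; apply is_derive_unique, H2.
Qed.

Lemma CR2_lin_comb (k : nat) (F G : R -> R -> R) (c d : R) :
  CR2 k F -> CR2 k G -> CR2 k (fun x y => c * F x y + d * G x y).
Proof.
revert F G; induction k as [|k IH]; intros F G.
- rewrite !CR2_0; intros HF HG x y.
  apply continuity_2d_pt_plus; apply continuity_2d_pt_mult;
    auto using continuity_2d_pt_const.
- rewrite !CR2_S; intros (D1 & D2 & H1 & H2 & C1 & C2) (E1 & E2 & I1 & I2 & K1 & K2).
  exists (fun x y => c * D1 x y + d * E1 x y), (fun x y => c * D2 x y + d * E2 x y).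
  split; [|split; [|split; now apply IH]]; intros x y;
  apply (is_derive_plus (V := R_NormedModule)).
  + apply (is_derive_scal (fun z => F z y)); apply H1.
  + apply (is_derive_scal (fun z => G z y)); apply I1.
  + apply (is_derive_scal (fun z => F x z)); apply H2.
  + apply (is_derive_scal (fun z => G x z)); apply I2.
Qed.

Lemma is_derive_affine (p c x : R) : is_derive (fun t => p + c * t) x c.
Proof. auto_derive; [exact I | ring]. Qed.

Lemma CR2_comp_linear (k : nat) (F : R -> R -> R) (c d c' d' : R) :
  CR2 k F -> CR2 k (fun x y => F (c * x + d * y) (c' * x + d' * y)).
Proof.
revert F; induction k as [|k IH]; intros F.
- rewrite !CR2_0; intros HF x y.
  assert (L : forall u v, continuous (fun z : R * R => u * fst z + v * snd z) (x, y)).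
  { intros u v.
    apply (continuous_plus (V := R_NormedModule) (fun z : R * R => u * fst z)
             (fun z : R * R => v * snd z)).
    - apply (continuous_scal_r (V := R_NormedModule) u (fun z : R * R => fst z)).
      apply continuous_fst.
    - apply (continuous_scal_r (V := R_NormedModule) v (fun z : R * R => snd z)).
      apply continuous_snd. }
  apply continuity_2d_pt_filterlim.
  apply (continuous_comp_2 (fun z : R * R => c * fst z + d * snd z)
           (fun z : R * R => c' * fst z + d' * snd z) F); [apply L..|].
  now apply continuity_2d_pt_filterlim.
- rewrite !CR2_S; intros (D1 & D2 & H1 & H2 & C1 & C2).
  pose proof (CR2_continuity k D1 C1) as HC.
  exists (fun x y => c * D1 (c * x + d * y) (c' * x + d' * y)
                     + c' * D2 (c * x + d * y) (c' * x + d' * y)),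
         (fun x y => d * D1 (c * x + d * y) (c' * x + d' * y)
                     + d' * D2 (c * x + d * y) (c' * x + d' * y)).
  split; [|split; [|split]].
  + intros x y; eapply is_derive_eq.
    * apply (is_derive_comp_2d F D1 D2 (fun z => c * z + d * y)
               (fun z => c' * z + d' * y) c c'); auto; auto_derive; auto; ring.
    * simpl; ring.
  + intros x y; eapply is_derive_eq.
    * apply (is_derive_comp_2d F D1 D2 (fun z => c * x + d * z)
               (fun z => c' * x + d' * z) d d'); auto; auto_derive; auto; ring.
    * simpl; ring.
  + apply (CR2_lin_comb k (fun x y => D1 (c * x + d * y) (c' * x + d' * y))
             (fun x y => D2 (c * x + d * y) (c' * x + d' * y))); now apply IH.
  + apply (CR2_lin_comb k (fun x y => D1 (c * x + d * y) (c' * x + d' * y))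
             (fun x y => D2 (c * x + d * y) (c' * x + d' * y))); now apply IH.
Qed.

Lemma CR2_line (k : nat) (F : R -> R -> R) (p q c d : R) :
  CR2 k F -> CR k (fun t => F (p + c * t) (q + d * t)).
Proof.
revert F; induction k as [|k IH]; intros F.
- rewrite CR2_0, CR_0; intros HF t.
  apply (continuous_comp_2 (fun t => p + c * t) (fun t => q + d * t) F).
  + apply (ex_derive_continuous (fun t => p + c * t)); eexists; apply is_derive_affine.
  + apply (ex_derive_continuous (fun t => q + d * t)); eexists; apply is_derive_affine.
  + now apply continuity_2d_pt_filterlim.
- rewrite CR2_S, CR_S; intros (D1 & D2 & H1 & H2 & C1 & C2).
  exists (fun t => D1 (p + c * t) (q + d * t) * c + D2 (p + c * t) (q + d * t) * d).
  split.
  + intros t; apply (is_derive_comp_2d F D1 D2 (fun t => p + c * t) (fun t => q + d * t));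
      auto using is_derive_affine; now apply (CR2_continuity k).
  + apply (CR_ext k (fun t => c * D1 (p + c * (1 * t)) (q + d * (1 * t))
                              + d * D2 (p + c * (1 * t)) (q + d * (1 * t)))).
    * intros t; rewrite Rmult_1_l; ring.
    * apply CR_plus.
      -- apply (CR_comp_scal k (fun t => D1 (p + c * t) (q + d * t))); now apply IH.
      -- apply (CR_comp_scal k (fun t => D2 (p + c * t) (q + d * t))); now apply IH.
Qed.

(** [dir_derive] differentiates at parameter 0 only. The chain rule gives the same expression in
    [D1] and [D2] at parameter [t] and at parameter 0 from the shifted base point. *)
Lemma is_derive_line (k : nat) (F : R -> R -> R) (l : R * R) (x y t : R) :
  CR2 (S k) F ->
  is_derive (fun t => F (x + t * fst l) (y + t * snd l)) t
    (dir_derive l F (x + t * fst l) (y + t * snd l)).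
Proof.
intros H; apply CR2_S in H; destruct H as (D1 & D2 & H1 & H2 & C1 & C2).
assert (Aff : forall p c z, is_derive (fun t => p + t * c) z c).
{ intros p c z; auto_derive; [exact I | ring]. }
assert (G : forall x y t,
  is_derive (fun t => F (x + t * fst l) (y + t * snd l)) t
    (D1 (x + t * fst l) (y + t * snd l) * fst l
     + D2 (x + t * fst l) (y + t * snd l) * snd l)).
{ intros x' y' z.
  apply (is_derive_comp_2d F D1 D2 (fun t => x' + t * fst l) (fun t => y' + t * snd l));
    auto; now apply (CR2_continuity k). }
eapply is_derive_eq; [apply G|].
unfold dir_derive; symmetry.
erewrite is_derive_unique; [|apply G].
now rewrite !Rmult_0_l, !Rplus_0_r.
Qed.

Lemma CR2_dir_derive (k : nat) (F : R -> R -> R) (l : R * R) :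
  CR2 (S k) F -> CR2 k (dir_derive l F).
Proof.
intros H; apply CR2_S in H; destruct H as (D1 & D2 & H1 & H2 & C1 & C2).
apply (CR2_ext k (fun x y => fst l * D1 x y + snd l * D2 x y));
  [|now apply CR2_lin_comb].
intros x y; unfold dir_derive; symmetry; apply is_derive_unique.
eapply is_derive_eq.
- apply (is_derive_comp_2d F D1 D2 (fun t => x + t * fst l) (fun t => y + t * snd l)
           (fst l) (snd l)); auto; [now apply (CR2_continuity k)|..];
    auto_derive; auto; ring.
- simpl; rewrite !Rmult_0_l, !Rplus_0_r; ring.
Qed.

(** * Finite sums and iterated directional derivatives *)

Lemma sum_n_m_Rminus (u v : nat -> R) (p q : nat) :
  sum_n_m u p q - sum_n_m v p q = sum_n_m (fun j => u j - v j) p q.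
Proof.
pose proof (sum_n_m_plus (G := R_AbelianMonoid) v (fun j => u j - v j) p q) as H.
rewrite (sum_n_m_ext _ u) in H by (intros j; unfold plus; simpl; ring).
unfold plus in H; simpl in H; lra.
Qed.

Lemma is_derive_sum_n_m (g : nat -> R -> R) (dg : nat -> R) (p q : nat) (t : R) :
  (forall j, (p <= j <= q)%nat -> is_derive (g j) t (dg j)) ->
  is_derive (fun z => sum_n_m (fun j => g j z) p q) t (sum_n_m dg p q).
Proof.
assert (Z : forall q, (q < p)%nat ->
  is_derive (fun z => sum_n_m (fun j => g j z) p q) t (sum_n_m dg p q)).
{ intros q' Hq; rewrite sum_n_m_zero by exact Hq.
  apply (is_derive_ext (fun _ => 0)).
  - intros z; now rewrite sum_n_m_zero.
  - apply (is_derive_const (V := R_NormedModule)). }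
induction q as [|q IH]; intros H.
- destruct p as [|p]; [|apply Z; lia].
  rewrite sum_n_n; apply (is_derive_ext (g 0%nat)); [|now apply H].
  intros z; now rewrite sum_n_n.
- destruct (le_dec p (S q)) as [Hp|Hp]; [|apply Z; lia].
  rewrite sum_n_Sm by exact Hp.
  apply (is_derive_ext (fun z => plus (sum_n_m (fun j => g j z) p q) (g (S q) z))).
  + intros z; now rewrite sum_n_Sm.
  + apply (is_derive_plus (V := R_NormedModule)).
    * apply IH; intros; apply H; lia.
    * apply H; lia.
Qed.

Lemma dir_derives_nil (l : nat -> R * R) (p q : nat) (F : R -> R -> R) :
  (q < p)%nat -> dir_derives l p q F = F.
Proof. intros H; unfold dir_derives; now replace (S q - p)%nat with 0%nat by lia. Qed.

Lemma dir_derives_cons (l : nat -> R * R) (p q : nat) (F : R -> R -> R) :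
  (p <= q)%nat ->
  dir_derives l p q F = dir_derive (l p) (dir_derives l (S p) q F).
Proof.
intros H; unfold dir_derives.
now replace (S q - p)%nat with (S (S q - S p)) by lia.
Qed.

Lemma dir_derives_snoc (l : nat -> R * R) (p q : nat) (F : R -> R -> R) :
  (p <= S q)%nat ->
  dir_derives l p (S q) F = dir_derives l p q (dir_derive (l (S q)) F).
Proof.
intros H; unfold dir_derives.
replace (S (S q) - p)%nat with (S (S q - p)) by lia.
rewrite seq_S, map_app, fold_right_app.
now replace (p + (S q - p))%nat with (S q) by lia.
Qed.

Lemma CR2_dir_derives (l : nat -> R * R) (k p q : nat) (F : R -> R -> R) :
  CR2 (k + (S q - p)) F -> CR2 k (dir_derives l p q F).
Proof.
unfold dir_derives; generalize (S q - p)%nat as m; intros m.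
revert k p; induction m as [|m IH]; intros k p H; simpl.
- now rewrite Nat.add_0_r in H.
- apply CR2_dir_derive, IH; now rewrite Nat.add_succ_r in H.
Qed.

(** * Splitting into a function of x plus a function of y, from differences to derivatives *)

(* [F] need not be differentiable here: this is the finite-difference form of
   "d^m F / dl_1 ... dl_m is a function of x plus a function of y". *)
Fixpoint splits_after_diff (l : nat -> R * R) (m : nat) (F : R -> R -> R) : Prop :=
  match m with
  | O => forall x y, F x y = F x 0 + F 0 y - F 0 0
  | S m' => forall c,
      splits_after_diff l m'
        (fun x y => F (x + c * fst (l m)) (y + c * snd (l m)) - F x y)
  end.

Lemma splits_after_diff_scal (l : nat -> R * R) (m : nat) (F G : R -> R -> R) (d : R) :
  (forall x y, G x y = d * F x y) ->
  splits_after_diff l m F -> splits_after_diff l m G.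
Proof.
revert F G; induction m as [|m IH]; intros F G E H.
- intros x y; rewrite !E, (H x y); ring.
- intros c; refine (IH _ _ _ (H c)); intros x y; simpl; rewrite !E; ring.
Qed.

(** Unfolded, the property is a family of linear identities, each between finitely many values of
    the function, so it survives pointwise limits. Nothing is asked of [G 0], as suits difference
    quotients. *)
Lemma splits_after_diff_lim (l : nat -> R * R) (m : nat)
    (G : R -> R -> R -> R) (F : R -> R -> R) :
  (forall t, t <> 0 -> splits_after_diff l m (G t)) ->
  (forall x y, is_lim (fun t => G t x y) 0 (F x y)) ->
  splits_after_diff l m F.
Proof.
revert G F; induction m as [|m IH]; intros G F HG HF.
- intros x y.
  assert (L : is_lim (fun t => G t x y) 0 (F x 0 + F 0 y - F 0 0)).
  { apply (is_lim_ext_loc (fun t => G t x 0 + G t 0 y - G t 0 0)).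
    - exists (mkposreal 1 Rlt_0_1); intros t _ Ht; symmetry; now apply HG.
    - apply is_lim_minus'; [apply is_lim_plus'|]; apply HF. }
  apply is_lim_unique in L; pose proof (is_lim_unique _ _ _ (HF x y)) as L'.
  rewrite L in L'; now injection L'.
- intros c.
  apply (IH (fun t x y => G t (x + c * fst (l (S m))) (y + c * snd (l (S m))) - G t x y)).
  + intros t Ht; exact (HG t Ht c).
  + intros x y; apply is_lim_minus'; apply HF.
Qed.

Lemma is_derive_is_lim (g : R -> R) (d : R) :
  is_derive g 0 d -> is_lim (fun t => / t * (g t - g 0)) 0 d.
Proof.
intros H; apply is_derive_Reals in H.
apply filterlim_locally; intros eps.
destruct (H eps (cond_pos eps)) as [delta Hd].
exists delta; intros t Ht Ht0.
assert (Ht' : Rabs t < delta).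
{ generalize Ht; unfold ball; simpl; unfold AbsRing_ball, abs, minus, plus, opp; simpl.
  now rewrite Ropp_0, Rplus_0_r. }
generalize (Hd t Ht0 Ht').
unfold ball; simpl; unfold AbsRing_ball, abs, minus, plus, opp; simpl.
rewrite Rplus_0_l; unfold Rdiv, Rminus; now rewrite (Rmult_comm (g t + - g 0)).
Qed.

(** The hypothesis with step [t] concerns the increment along [l (S m)]; dividing by [t] and letting
    [t] tend to 0 replaces this increment by the derivative. *)
Lemma splits_after_diff_dir_derive (l : nat -> R * R) (m k : nat) (F : R -> R -> R) :
  CR2 (S k) F -> splits_after_diff l (S m) F ->
  splits_after_diff l m (dir_derive (l (S m)) F).
Proof.
intros HF H.
apply (splits_after_diff_lim l m
  (fun t x y => / t * (F (x + t * fst (l (S m))) (y + t * snd (l (S m))) - F x y))).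
- intros t _; now apply (splits_after_diff_scal l m _ _ (/ t) (fun _ _ => eq_refl)).
- intros x y.
  pose proof (is_derive_line k F (l (S m)) x y 0 HF) as D.
  apply is_derive_is_lim in D.
  rewrite !Rmult_0_l, !Rplus_0_r in D; exact D.
Qed.

(** Differences are converted into derivatives one at a time, beginning with [l m]: it is both the
    outermost difference in [splits_after_diff] and the derivative applied first in
    [dir_derives]. *)
Lemma splits_dir_derives (l : nat -> R * R) (m k : nat) (F : R -> R -> R) :
  CR2 (k + m) F -> splits_after_diff l m F ->
  forall x y, dir_derives l 1 m F x y =
    dir_derives l 1 m F x 0 + dir_derives l 1 m F 0 y - dir_derives l 1 m F 0 0.
Proof.
revert F; induction m as [|m IH]; intros F HF H.
- exact H.
- rewrite dir_derives_snoc by lia; rewrite Nat.add_succ_r in HF.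
  apply IH; [now apply CR2_dir_derive | now apply (splits_after_diff_dir_derive l m (k + m))].
Qed.

(** A difference keeps the form of the sum: [u], [v] and every [w j] are replaced by increments of
    their own, and the last ridge term drops out. Hence the induction with [u], [v], [w]
    arbitrary. *)
Lemma ridge_splits_after_diff (l : nat -> R * R) (A B : nat -> R) (m : nat)
    (u v : R -> R) (w : nat -> R -> R) (F : R -> R -> R) :
  (forall j, (1 <= j <= m)%nat -> A j * fst (l j) + B j * snd (l j) = 0) ->
  (forall x y, F x y = u x + v y + sum_n_m (fun j => w j (A j * x + B j * y)) 1 m) ->
  splits_after_diff l m F.
Proof.
revert u v w F; induction m as [|m IH]; intros u v w F Hl HF.
- intros x y; rewrite !HF, !sum_n_m_zero by lia; ring.
- intros c; set (d := l (S m)).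
  apply (IH (fun x => u (x + c * fst d) - u x) (fun y => v (y + c * snd d) - v y)
           (fun j t => w j (t + c * (A j * fst d + B j * snd d)) - w j t)).
  + intros j Hj; apply Hl; lia.
  + intros x y; fold d; rewrite !HF, <- sum_n_m_Rminus.
    rewrite !(sum_n_Sm _ 1 m) by lia.
    (* The argument of the last ridge function moves by [c] times an inner product that is 0 by
       orthogonality. *)
    replace (A (S m) * (x + c * fst d) + B (S m) * (y + c * snd d))
      with (A (S m) * x + B (S m) * y + c * (A (S m) * fst d + B (S m) * snd d)) by ring.
    unfold d at 5 6; rewrite Hl by lia; rewrite Rmult_0_r, Rplus_0_r.
    rewrite (sum_n_m_ext (fun j => w j (A j * (x + c * fst d) + B j * (y + c * snd d)))
      (fun j => w j (A j * x + B j * y + c * (A j * fst d + B j * snd d)))).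
    * unfold plus; simpl; ring.
    * intros j; f_equal; ring.
Qed.

Lemma constant_along_line (g : R -> R) :
  (forall t, is_derive g t 0) -> forall t, g 0 = g t.
Proof.
intros H t; destruct (Rtotal_order 0 t) as [Ht|[<-|Ht]]; [|reflexivity|symmetry];
  apply (eq_is_derive (V := R_NormedModule) g); auto.
Qed.

(** * Integrating the splitting back along the directions l_1, ..., l_(n-2) *)

Section Ridge.

Context (n : nat) (a b : nat -> R) (f : R -> R -> R).

Let A := ta n a b.
Let B := tb n a b.
Let L := ldir n a b.
(** [D 1] is the derivative along all directions, and [D (S (n - 2))] is [fstar] itself, as its
    range of directions is empty. *)
Let D (p : nat) := dir_derives L p (n - 2) (fstar n a b f).

Lemma ldir_orth (p : nat) : A p * fst (L p) + B p * snd (L p) = 0.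
Proof. unfold L, ldir, A, B; cbn [fst snd]; unfold Rdiv; ring. Qed.

(** [HA], [HB] and [HAB] express that e_1, e_2 and the vectors [(A p, B p)] are pairwise
    independent, so that no divisor of the construction vanishes. *)
Hypothesis HA : forall p, (1 <= p <= n - 2)%nat -> A p <> 0.
Hypothesis HB : forall p, (1 <= p <= n - 2)%nat -> B p <> 0.
Hypothesis HAB : forall j p, (1 <= j <= n - 2)%nat -> (1 <= p <= n - 2)%nat ->
  j <> p -> A j * B p - B j * A p <> 0.

Lemma norm2_pos (p : nat) : (1 <= p <= n - 2)%nat -> 0 < A p ^ 2 + B p ^ 2.
Proof.
intros Hp; pose proof (pow2_gt_0 _ (HA p Hp)); pose proof (pow2_ge_0 (B p)); lra.
Qed.

Lemma fst_ldir_neq_0 (p : nat) : (1 <= p <= n - 2)%nat -> fst (L p) <> 0.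
Proof.
intros Hp; simpl; apply Rmult_integral_contrapositive; split; [now apply HB|].
apply Rinv_neq_0_compat, Rgt_not_eq, sqrt_lt_R0, (norm2_pos p Hp).
Qed.

Lemma snd_ldir_neq_0 (p : nat) : (1 <= p <= n - 2)%nat -> snd (L p) <> 0.
Proof.
intros Hp; simpl; apply Rmult_integral_contrapositive; split.
- now apply Ropp_neq_0_compat, HA.
- apply Rinv_neq_0_compat, Rgt_not_eq, sqrt_lt_R0, (norm2_pos p Hp).
Qed.

Lemma dot_ldir_neq_0 (j p : nat) :
  (1 <= j <= n - 2)%nat -> (1 <= p <= n - 2)%nat -> j <> p ->
  A j * fst (L p) + B j * snd (L p) <> 0.
Proof.
intros Hj Hp Hjp.
replace (A j * fst (L p) + B j * snd (L p))
  with ((A j * B p - B j * A p) * / sqrt (A p ^ 2 + B p ^ 2)).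
- apply Rmult_integral_contrapositive; split; [now apply HAB|].
  apply Rinv_neq_0_compat, Rgt_not_eq, sqrt_lt_R0, (norm2_pos p Hp).
- unfold L, ldir; cbn [fst snd]; unfold A, B, Rdiv; ring.
Qed.

(* (x, y) and its orthogonal projection onto the line R (A p, B p) differ by a
   multiple of l_p. *)
Lemma projection_on_line (p : nat) (x y : R) :
  (1 <= p <= n - 2)%nat ->
  exists t,
    A p * (A p * x + B p * y) / (A p ^ 2 + B p ^ 2) = x + t * fst (L p) /\
    B p * (A p * x + B p * y) / (A p ^ 2 + B p ^ 2) = y + t * snd (L p).
Proof.
intros Hp; pose proof (norm2_pos p Hp) as HN.
(* Minus the coordinate of [(x, y)] along the unit vector l_p. *)
exists ((A p * y - B p * x) / sqrt (A p ^ 2 + B p ^ 2)).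
pose proof (sqrt_lt_R0 _ HN) as Hr; pose proof (sqrt_sqrt _ (Rlt_le _ _ HN)) as Hrr.
unfold L, ldir; cbn [fst snd]; fold A B.
change (ta n a b p) with (A p); change (tb n a b p) with (B p).
set (r := sqrt (A p ^ 2 + B p ^ 2)) in *.
rewrite <- Hrr; split; apply (Rmult_eq_reg_r (r * r)); try nra; field_simplify;
  try nra; replace (r ^ 2) with (A p ^ 2 + B p ^ 2) by (rewrite <- Hrr; ring); ring.
Qed.

Let Phi := phi n a b f.
Let H1 := h1 n a b f.
Let H2 := h2 n a b f.

(** After stage [p] the derivatives along l_1, ..., l_p have been undone. The order [k + p] grows
    with each integration, in step with the regularity of [D (S p)]; the smoothness is part of the
    induction because it justifies differentiating the primitives. *)
Lemma dir_derives_ridge (k : nat) :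
  CR2 (k + (n - 2)) (fstar n a b f) ->
  (forall x y, D 1 x y = D 1 x 0 + D 1 0 y - D 1 0 0) ->
  forall p, (p <= n - 2)%nat ->
  (CR (k + p) (H1 (S p)) /\ CR (k + p) (H2 (S p)) /\
   forall j, (1 <= j <= p)%nat -> CR (k + p) (Phi j (S p - j))) /\
  forall x y, D (S p) x y =
    H1 (S p) x + H2 (S p) y + sum_n_m (fun j => Phi j (S p - j) (A j * x + B j * y)) 1 p.
Proof.
intros Hf Hsplit.
assert (HD : forall p, (p <= n - 2)%nat -> CR2 (k + p) (D (S p))).
{ intros p Hp; apply CR2_dir_derives.
  now replace (k + p + (S (n - 2) - S p))%nat with (k + (n - 2))%nat by lia. }
induction p as [|p IH]; intros Hp.
- pose proof (HD 0%nat Hp) as HD0; repeat apply conj.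
  + apply (CR_ext (k + 0) (fun t => D 1 (0 + 1 * t) (0 + 0 * t))).
    * intros t; unfold H1; rewrite h1_1; unfold D; f_equal; ring.
    * now apply CR2_line.
  + apply (CR_ext (k + 0) (fun t => D 1 (0 + 0 * t) (0 + 1 * t)
                                    - D 1 (0 + 0 * t) (0 + 0 * t))).
    * intros t; unfold H2; rewrite h2_1; unfold D; f_equal; [|f_equal]; f_equal; ring.
    * apply CR_minus; now apply CR2_line.
  + intros j Hj; lia.
  + intros x y; rewrite sum_n_m_zero by lia.
    rewrite Hsplit; unfold H1, H2; rewrite h1_1, h2_1; unfold D, L, zero; simpl; ring.
- destruct (IH ltac:(lia)) as ((C1 & C2 & CPhi) & E); clear IH.
  assert (Hp' : (1 <= S p <= n - 2)%nat) by lia.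
  set (P := S p) in *.
  assert (Ph1 : forall t, H1 (S P) t = 1 / fst (L P) * RInt (H1 P) 0 t).
  { intros t; unfold H1; rewrite <- (Nat.add_1_r P), h1_S by lia.
    unfold dot; cbn [fst snd]; fold L; now rewrite Rmult_1_l, Rmult_0_l, Rplus_0_r. }
  assert (Ph2 : forall t, H2 (S P) t = 1 / snd (L P) * RInt (H2 P) 0 t).
  { intros t; unfold H2; rewrite <- (Nat.add_1_r P), h2_S by lia.
    unfold dot; cbn [fst snd]; fold L; now rewrite Rmult_1_l, Rmult_0_l, Rplus_0_l. }
  (* The second index of [Phi j] is [P - j], so the direction [k + j] in [phi_S] is l_P for every
     [j]: all summands are integrated along the same direction. *)
  assert (PPhi : forall j, (1 <= j <= p)%nat -> forall t,
    Phi j (S P - j) t =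
    1 / (A j * fst (L P) + B j * snd (L P)) * RInt (Phi j (P - j)) 0 t).
  { intros j Hj t; unfold Phi.
    replace (S P - j)%nat with (P - j + 1)%nat by lia.
    rewrite phi_S by lia; now replace (P - j + j)%nat with P by lia. }
  (* What remains of [D (S P)] once the termwise primitives are removed; it will be the ridge
     function of index [P]. *)
  set (G := fun x y => D (S P) x y - H1 (S P) x - H2 (S P) y
    - sum_n_m (fun j => Phi j (S P - j) (A j * x + B j * y)) 1 p).
  assert (KP : (k + P = S (k + p))%nat) by lia.
  assert (NC1 : CR (k + P) (H1 (S P))).
  { rewrite KP; apply (CR_ext _ _ _ (fun t => eq_sym (Ph1 t))); now apply CR_primitive. }
  assert (NC2 : CR (k + P) (H2 (S P))).
  { rewrite KP; apply (CR_ext _ _ _ (fun t => eq_sym (Ph2 t))); now apply CR_primitive. }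
  assert (NCPhi : forall j, (1 <= j <= p)%nat -> CR (k + P) (Phi j (S P - j))).
  { intros j Hj; rewrite KP; apply (CR_ext _ _ _ (fun t => eq_sym (PPhi j Hj t))).
    now apply CR_primitive, CPhi. }
  assert (Aff : forall u c t, is_derive (fun z => u + z * c) t c).
  { intros u c t; auto_derive; [exact I | ring]. }
  (* Along l_P the argument of each summand moves with speed [c], its inner product with l_P; this
     factor of the chain rule cancels the [1 / c] in the recurrence. *)
  assert (Prim : forall g G c u t, c <> 0 -> (forall z, continuous g z) ->
    (forall z, G z = 1 / c * RInt g 0 z) ->
    is_derive (fun z => G (u + z * c)) t (g (u + t * c))).
  { intros g G0 c u t Hc Hg HG.
    apply (is_derive_ext (fun z => 1 / c * RInt g 0 (u + z * c))).
    { intros z; now rewrite HG. }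
    eapply is_derive_eq.
    - apply (is_derive_comp (V := R_NormedModule) (fun w => 1 / c * RInt g 0 w)
        (fun z => u + z * c)); [now apply is_derive_primitive | apply Aff].
    - unfold scal; simpl; unfold mult; simpl; now field. }
  assert (dG : forall x y t,
    is_derive (fun t => G (x + t * fst (L P)) (y + t * snd (L P))) t 0).
  { intros x y t; unfold G; eapply is_derive_eq.
    - apply (is_derive_minus (V := R_NormedModule)); [apply (is_derive_minus (V := R_NormedModule));
        [apply (is_derive_minus (V := R_NormedModule))|]|].
      + apply (is_derive_line (k + p)); rewrite <- KP; now apply HD.
      + apply (Prim (H1 P)); auto; [now apply fst_ldir_neq_0|].
        now apply (CR_continuous (k + p)).
      + apply (Prim (H2 P)); auto; [now apply snd_ldir_neq_0|].
        now apply (CR_continuous (k + p)).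
      + apply (is_derive_sum_n_m (fun j t => Phi j (S P - j)%nat
            (A j * (x + t * fst (L P)) + B j * (y + t * snd (L P))))
          (fun j => Phi j (P - j)%nat
            (A j * (x + t * fst (L P)) + B j * (y + t * snd (L P))))).
        intros j Hj.
        set (c := A j * fst (L P) + B j * snd (L P)).
        assert (Ej : forall z, A j * x + B j * y + z * c =
          A j * (x + z * fst (L P)) + B j * (y + z * snd (L P)))
          by (intros z; unfold c; ring).
        apply (is_derive_ext (fun z => Phi j (S P - j)%nat (A j * x + B j * y + z * c))).
        { intros z; now rewrite Ej. }
        rewrite <- Ej; apply (Prim (Phi j (P - j)%nat)).
        * apply dot_ldir_neq_0; lia.
        * now apply (CR_continuous (k + p)), CPhi.
        * now apply PPhi.
    (* Differentiating [D (S P)] along l_P gives [D P], and the vanishing is the representation of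
       the previous stage. *)
    - match goal with |- minus (minus (minus ?u ?v) ?w) ?z = 0 =>
        change (u - v - w - z = 0) end.
      replace (dir_derive (L P) (D (S P))) with (D P) by (apply dir_derives_cons; lia).
      rewrite E; ring. }
  (* The definition of [phi] at second index 1 is [G] evaluated on the line through [(A P, B P)]. *)
  assert (phi1 : forall t, Phi P 1 t =
    G (A P * t / (A P ^ 2 + B P ^ 2)) (B P * t / (A P ^ 2 + B P ^ 2))).
  { intros t; unfold Phi; rewrite phi_1 by lia.
    unfold G; rewrite Nat.add_1_r; fold A B; f_equal.
    replace (P - 1)%nat with p by lia.
    apply sum_n_m_ext_loc; intros j Hj.
    replace (P - j + 1)%nat with (S P - j)%nat by lia.
    fold Phi; f_equal; field; apply Rgt_not_eq, (norm2_pos P Hp'). }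
  repeat apply conj; [exact NC1 | exact NC2 | |].
  + intros j Hj; destruct (Nat.eq_dec j P) as [->|Hj']; [|apply NCPhi; lia].
    replace (S P - P)%nat with 1%nat by lia.
    apply (CR_ext _ _ _ (fun t => eq_sym (phi1 t))).
    set (c := A P / (A P ^ 2 + B P ^ 2)); set (d := B P / (A P ^ 2 + B P ^ 2)).
    (* [Phi P 1] is not a primitive; its smoothness comes from that of [D (S P)] on a line and of
       the other summands after rescaling. *)
    apply (CR_ext (k + P) (fun t =>
      D (S P) (0 + c * t) (0 + d * t) - 1 * H1 (S P) (c * t) - 1 * H2 (S P) (d * t)
      - sum_n_m (fun j => 1 * Phi j (S P - j)%nat ((A j * c + B j * d) * t)) 1 p)).
    * intros t.
      replace (A P * t / (A P ^ 2 + B P ^ 2)) with (c * t) by (unfold c, Rdiv; ring).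
      replace (B P * t / (A P ^ 2 + B P ^ 2)) with (d * t) by (unfold d, Rdiv; ring).
      unfold G; rewrite !Rplus_0_l, !Rmult_1_l; f_equal.
      apply sum_n_m_ext; intros i; rewrite Rmult_1_l; f_equal; ring.
    * apply CR_minus; [apply CR_minus; [apply CR_minus|]|].
      -- now apply CR2_line, HD.
      -- now apply CR_comp_scal.
      -- now apply CR_comp_scal.
      -- apply (CR_sum _ (fun j t => 1 * Phi j (S P - j)%nat ((A j * c + B j * d) * t))).
         intros i Hi; now apply CR_comp_scal, NCPhi.
  + intros x y; unfold P at 5; rewrite sum_n_Sm by lia; fold P.
    replace (S P - P)%nat with 1%nat by lia; rewrite phi1.
    (* The new summand is [G] at the projection of [(x, y)], hence [G x y], since the two points
       differ along l_P; the definition of [G] then gives the sum. *)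
    destruct (projection_on_line P x y Hp') as (t & -> & ->).
    rewrite <- (constant_along_line _ (dG x y) t).
    rewrite !Rmult_0_l, !Rplus_0_r; unfold G, plus; simpl; ring.
Qed.

End Ridge.

(** * Change of coordinates and assembly of the representation *)

(** A zero determinant makes [(snd v, - snd u)] and [(fst v, - fst u)] coefficients of linear
    relations, so both vectors vanish and [(1, 0)] is a relation too. *)
Lemma lin_indep_det (u v : R * R) :
  lin_indep u v -> fst u * snd v - fst v * snd u <> 0.
Proof.
intros H E.
destruct (H (snd v) (- snd u)) as [E1 E2]; [lra | ring|].
destruct (H (fst v) (- fst u)) as [E3 E4]; [ring | lra|].
destruct (H 1 0) as [Hc _]; nra.
Qed.

Theorem theorem2p11 (n : nat) (hn : (2 <= n)%nat) (a b : nat -> R)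
  (hab : forall i j : nat, (1 <= i <= n)%nat -> (1 <= j <= n)%nat -> i <> j ->
     lin_indep (a i, b i) (a j, b j))
  (s : nat) (hs : (n - 2 <= s)%nat)
  (f : R -> R -> R) (hf : CR2 s f)
  (fi : nat -> R -> R)
  (hrep : forall x y : R,
     f x y = sum_n_m (fun i => fi i (a i * x + b i * y)) 1 n) :
  exists g : nat -> R -> R,
    (forall i : nat, (1 <= i <= n)%nat -> CR s (g i)) /\
    (forall x y : R,
       f x y = sum_n_m (fun i => g i (a i * x + b i * y)) 1 n) /\
    (forall (p : nat) (t : R), (1 <= p <= n - 2)%nat ->
       g p t = phi n a b f p (n - p - 1) t) /\
    (forall t : R, g (n - 1)%nat t = h1 n a b f (n - 1) t) /\
    (forall t : R, g n t = h2 n a b f (n - 1) t).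
Proof.
assert (Hdet : forall i j, (1 <= i <= n)%nat -> (1 <= j <= n)%nat -> i <> j ->
  a i * b j - a j * b i <> 0).
{ intros i j Hi Hj Hij; exact (lin_indep_det _ _ (hab i j Hi Hj Hij)). }
set (q := (n - 1)%nat).
assert (Hd : a q * b n - a n * b q <> 0) by (apply Hdet; unfold q; lia).
assert (Hd' : a n * b q - a q * b n <> 0) by (intros E; apply Hd; lra).
assert (HA : forall p, (1 <= p <= n - 2)%nat -> ta n a b p <> 0).
{ intros p Hp; apply Rmult_integral_contrapositive; split;
    [apply Hdet; lia | now apply Rinv_neq_0_compat]. }
assert (HB : forall p, (1 <= p <= n - 2)%nat -> tb n a b p <> 0).
{ intros p Hp; apply Rmult_integral_contrapositive; split;
    [apply Hdet; lia | now apply Rinv_neq_0_compat]. }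
assert (HAB : forall j p, (1 <= j <= n - 2)%nat -> (1 <= p <= n - 2)%nat -> j <> p ->
  ta n a b j * tb n a b p - tb n a b j * ta n a b p <> 0).
{ intros j p Hj Hp Hjp.
  replace (ta n a b j * tb n a b p - tb n a b j * ta n a b p)
    with ((a j * b p - a p * b j) / (a q * b n - a n * b q)).
  - apply Rmult_integral_contrapositive; split;
      [apply Hdet; lia | now apply Rinv_neq_0_compat].
  - unfold ta, tb; fold q; now field. }
(* Cramer's rule: [ta] and [tb] are the coordinates of [(a p, b p)] in the basis formed by the last
   two vectors. *)
assert (Hta : forall p x y,
  ta n a b p * (a q * x + b q * y) + tb n a b p * (a n * x + b n * y) = a p * x + b p * y).
{ intros p x y; unfold ta, tb; fold q; now field. }
assert (Hfstar : forall x y, f x y = fstar n a b f (a q * x + b q * y) (a n * x + b n * y)).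
{ intros x y; unfold fstar; fold q; f_equal; field; auto. }
assert (Hfs : CR2 (s - (n - 2) + (n - 2)) (fstar n a b f)).
{ replace (s - (n - 2) + (n - 2))%nat with s by lia.
  set (d := a q * b n - a n * b q); set (d' := a n * b q - a q * b n).
  apply (CR2_ext s (fun x y => f (b n / d * x + - b q / d * y) (a n / d' * x + - a q / d' * y))).
  - intros x y; unfold fstar; fold q; fold d d'; f_equal; unfold Rdiv; ring.
  - now apply CR2_comp_linear. }
assert (Hsum : forall u : nat -> R,
  sum_n_m u 1 n = sum_n_m u 1 (n - 2) + u q + u n).
{ intros u; destruct n as [|[|m]]; [lia | lia|]; unfold q; simpl Nat.sub.
  rewrite Nat.sub_0_r, !sum_n_Sm by lia; reflexivity. }
(* The given representation enters only here, with the arbitrary [fi] as ridge functions and the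
   last two as functions of one coordinate each. *)
assert (Hsplit : splits_after_diff (ldir n a b) (n - 2) (fstar n a b f)).
{ apply (ridge_splits_after_diff _ (ta n a b) (tb n a b) _ (fi q) (fi n) fi).
  - intros j _; apply ldir_orth.
  - intros x y; unfold fstar; fold q; rewrite hrep, Hsum.
    rewrite (Rplus_comm (sum_n_m _ _ _)), Rplus_assoc, (Rplus_comm (sum_n_m _ _ _)), <- Rplus_assoc.
    f_equal; [f_equal; f_equal; now field|].
    apply sum_n_m_ext; intros j; f_equal; unfold ta, tb; fold q; now field. }
(* The last stage, [p = n - 2]: the order is [s - (n - 2) + (n - 2) = s], and the function
   represented is [fstar]. *)
destruct (dir_derives_ridge n a b f HA HB HAB (s - (n - 2)) Hfs
  (splits_dir_derives _ _ _ _ Hfs Hsplit) (n - 2) (Nat.le_refl _))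
  as ((C1 & C2 & CPhi) & E).
rewrite dir_derives_nil in E by lia.
replace (s - (n - 2) + (n - 2))%nat with s in * by lia.
replace (S (n - 2)) with q in * by (unfold q; lia).
exists (fun i => if le_dec i (n - 2) then phi n a b f i (n - i - 1)
                 else if Nat.eq_dec i q then h1 n a b f q else h2 n a b f q).
assert (Gphi : forall i (X Y : R -> R), (i <= n - 2)%nat ->
  (if le_dec i (n - 2) then X else Y) = X).
{ intros i X Y Hi; now destruct (le_dec i (n - 2)). }
repeat apply conj.
- intros i Hi; destruct (le_dec i (n - 2)); [|destruct (Nat.eq_dec i q); assumption].
  replace (n - i - 1)%nat with (q - i)%nat by lia; apply CPhi; lia.
- intros x y; rewrite Hfstar, E, Hsum.
  destruct (le_dec q (n - 2)); [lia|]; destruct (le_dec n (n - 2)); [lia|].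
  destruct (Nat.eq_dec q q); [|lia]; destruct (Nat.eq_dec n q); [lia|].
  rewrite (sum_n_m_ext_loc _ (fun i =>
    (if le_dec i (n - 2) then phi n a b f i (n - i - 1)
     else if Nat.eq_dec i q then h1 n a b f q else h2 n a b f q) (a i * x + b i * y))).
  + ring.
  + intros j Hj; rewrite Gphi by lia; rewrite Hta.
    now replace (n - j - 1)%nat with (q - j)%nat by lia.
- intros p t Hp; now rewrite Gphi by lia.
- intros t; fold q; destruct (le_dec q (n - 2)); [lia|].
  now destruct (Nat.eq_dec q q).
- intros t; fold q; destruct (le_dec n (n - 2)); [lia|].
  destruct (Nat.eq_dec n q); [lia|reflexivity].
Qed.
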